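(* Let $N\ge2$ and let $H_1,\dots,H_N$ be nonzero complex Hilbert spaces whose dimensions $n_k=\dim H_k$ satisfy $n_1\le n_2\le\cdots\le n_N$ and $n_{N-1}<\infty$ ($n_N$ may be infinite). Let $V$ be the set of all decomposable unit vectors in $H_1\otimes\cdots\otimes H_N$. Assume $n_N\ge n_1\cdots n_{N-1}$. Then $$r(V)=\frac1{\sqrt{n_1\cdots n_{N-1}}},$$ and every vector of the form $$\xi=\frac1{\sqrt{n_1\cdots n_{N-1}}}\sum_{i_1=1}^{n_1}\cdots\sum_{i_{N-1}=1}^{n_{N-1}}e^1_{i_1}\otimes\cdots\otimes e^{N-1}_{i_{N-1}}\otimes f_{i_1,\dots,i_{N-1}},$$ where $\{e^k_1,\dots,e^k_{n_k}\}$ is an orthonormal basis for $H_k$ ($1\le k\le N-1$) and $\{f_{i_1,\dots,i_{N-1}}:1\le i_k\le n_k,\ 1\le k\le N-1\}$ is an orthonormal set in $H_N$ (indexed so that distinct indices give orthogonal unit vectors), is a maximal vector.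
   Context: $V=\{\xi_1\otimes\cdots\otimes\xi_N:\xi_k\in H_k,\ \|\xi_1\|=\cdots=\|\xi_N\|=1\}$. The inner radius $r(V)$ is the largest $r\ge0$ such that $\{\xi\in H_1\otimes\cdots\otimes H_N:\|\xi\|\le r\}$ is contained in the (norm-)closed convex hull of $V$. With $d(\xi,V)=\inf\{\|\xi-\eta\|:\eta\in V\}$, a maximal vector is a unit vector $\xi$ with $d(\xi,V)=\sup_{\|\eta\|=1}d(\eta,V)$. *)

(* Defs.v *)
From HB Require Import structures.
From mathcomp Require Import all_boot all_order all_algebra.
From mathcomp Require Import complex sesquilinear.
From mathcomp Require Import all_classical all_reals all_analysis.

Set Implicit Arguments.
Unset Strict Implicit.
Unset Printing Implicit Defensive.

Import Order.TTheory GRing.Theory Num.Theory.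
Import numFieldNormedType.Exports.

Local Open Scope classical_set_scope.
Local Open Scope ring_scope.

(* Complex Hilbert spaces. The inner product is linear in its first argument
   and conjugate-linear in its second one. *)
HB.mixin Record CompleteNormedModule_isHilbert (R : realType) V
    & CompleteNormedModule R[i] V := {
  inner : {dot V for Num.conj} ;
  sqr_norm_inner : forall x : V, `|x| ^+ 2 = inner x x
}.

#[short(type="hilbertType")]
HB.structure Definition Hilbert (R : realType) :=
  {V of CompleteNormedModule_isHilbert R V & CompleteNormedModule R[i] V}.

Arguments inner {R s}.

Section HilbertSpaces.
Context {R : realType}.

(* The norm of a normed module over R[i] takes its values in R[i]; these values
   are nonnegative reals, and hnorm x is the norm of x seen in R. *)
Definition hnorm (V : hilbertType R) (x : V) : R := complex.Re `|x|.

Definition linear_span (V : hilbertType R) (A : set V) : set V :=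
  [set x | exists (n : nat) (a : 'I_n -> R[i]) (v : 'I_n -> V),
    (forall i, A (v i)) /\ x = \sum_(i < n) a i *: v i].

Definition orthonormal_family (V : hilbertType R) (I : eqType) (e : I -> V) :=
  forall i j, inner (e i) (e j) = (i == j)%:R.

Definition orthonormal_basis (V : hilbertType R) (I : eqType) (e : I -> V) :=
  orthonormal_family e /\ closure (linear_span (range e)) = setT.

(* Dimensions in nat with infinity; None stands for infinity. *)
Definition hilbert_dim (V : hilbertType R) (d : option nat) : Prop :=
  if d is Some n then exists e : 'I_n -> V, orthonormal_basis e
  else forall (n : nat) (e : 'I_n -> V), ~ orthonormal_basis e.

Definition closed_convex_hull (V : hilbertType R) (A : set V) : set V :=
  closure (smallest (fun B : set V => convex_set (B : set (convex_lmodType V))) A).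

Definition is_inner_radius (V : hilbertType R) (A : set V) (r : R) : Prop :=
  let admissible s :=
    0 <= s /\ [set x : V | hnorm x <= s] `<=` closed_convex_hull A in
  admissible r /\ forall s, admissible s -> s <= r.

Definition dist_to (V : hilbertType R) (A : set V) (x : V) : R :=
  inf [set hnorm (x - y) | y in A].

Definition maximal_vector (V : hilbertType R) (A : set V) (x : V) : Prop :=
  hnorm x = 1 /\
  dist_to A x = sup [set dist_to A y | y in [set y | hnorm y = 1]].

End HilbertSpaces.

Definition dim_le (a b : option nat) : bool :=
  match a, b with
  | _, None => true
  | Some p, Some q => (p <= q)%N
  | None, Some _ => false
  end.

(* A Hilbert space tensor product of the H k, given as a Hilbert space with a
   multilinear map tens from the product of the H k that multiplies inner
   products and has total range; these data are unique up to a unique unitary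
   isomorphism compatible with tens.
   dfwith x u is the family x with its k-th entry replaced by u : H k. *)
Record hilbertTensor (R : realType) (I : finType) (H : I -> hilbertType R) := {
  tensor_space :> hilbertType R ;
  tens : (forall k, H k) -> tensor_space ;
  tens_multilinear : forall (x : forall k, H k) (k : I) (a : R[i]) (u v : H k),
    tens (eqtype.dfwith x (a *: u + v)) = a *: tens (eqtype.dfwith x u) + tens (eqtype.dfwith x v) ;
  inner_tens : forall x y : forall k, H k,
    inner (tens x) (tens y) = \prod_k inner (x k) (y k) ;
  tens_total : closure (linear_span (range tens)) = setT
}.

Definition decomposable_unit (R : realType) (I : finType)
    (H : I -> hilbertType R) (T : hilbertTensor H) : set T :=
  [set tens T x | x in [set x : forall k, H k | forall k, hnorm (x k) = 1]].
Arguments decomposable_unit {R I H} T.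

(* The family indexed by 'I_m.+1 with first m entries x and last entry y. *)
Definition snoc_fam (m : nat) (H : 'I_m.+1 -> Type)
    (x : forall k : 'I_m, H (lift ord_max k)) (y : H ord_max) :
    forall k, H k :=
  fun k => match unliftP ord_max k with
           | UnliftSome j kE => ecast i (H i) (esym kE) (x j)
           | UnliftNone kE => ecast i (H i) (esym kE) y
           end.

Lemma snoc_fam_lift (m : nat) (H : 'I_m.+1 -> Type) x (y : H ord_max) k :
  snoc_fam x y (lift ord_max k) = x k.
Proof.
rewrite /snoc_fam; case: unliftP => [j kE|kE]; last first.
  by exfalso; have := neq_lift ord_max k; rewrite kE eqxx.
have kj := lift_inj kE; subst j.
by rewrite (eq_irrelevance kE erefl).
Qed.

Lemma snoc_fam_max (m : nat) (H : 'I_m.+1 -> Type) x (y : H ord_max) :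
  snoc_fam x y ord_max = y.
Proof.
rewrite /snoc_fam; case: unliftP => [j kE|kE].
  by exfalso; have := neq_lift ord_max j; rewrite -kE eqxx.
by rewrite (eq_irrelevance kE erefl).
Qed.

(* Main.v *)
Require Import Defs.
From mathcomp Require Import all_boot all_order all_algebra.
From mathcomp Require Import complex sesquilinear.
From mathcomp Require Import all_classical all_reals all_analysis.
From mathcomp Require Import ring lra.

Set Implicit Arguments.
Unset Strict Implicit.
Unset Printing Implicit Defensive.

Import Order.TTheory GRing.Theory Num.Theory.
Import numFieldNormedType.Exports.

Local Open Scope classical_set_scope.
Local Open Scope ring_scope.

(* A vector w = sum_i e_i (x) g_i, with e_i = e^1_(i_1) (x) ... (x) e^(N-1)_(i_(N-1)),
   has |w|^2 = sum_i |g_i|^2, so if |w| <= r := 1 / sqrt(n_1 ... n_(N-1)), then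
   sum_i |g_i| <= 1 by Cauchy-Schwarz and w is a convex combination of 0 and of
   the decomposable unit vectors e_i (x) g_i / |g_i|. Such w are dense, hence the
   ball of radius r lies in the closed convex hull of V. Conversely, Bessel's
   inequality gives Re <v, xi> <= r for v in V, hence for v in the closed convex
   hull; taking v = s xi shows that no ball of radius s > r fits in the hull.
   Finally |y - v|^2 = 2 - 2 Re <y, v> for unit vectors, so the two bounds read
   d(y, V) <= sqrt(2 - 2 r) <= d(xi, V) for every unit vector y. *)

(** * Real and complex inner products, the norm, and Cauchy-Schwarz *)

Section InnerProduct.
Context {R : realType}.
Local Notation C := R[i].
Implicit Types V : hilbertType R.

(** This is the inner product of the underlying real space. Half-spaces and distances only involve
    real parts, so the geometric arguments are carried out with it. *)
Definition rinner V (x y : V) : R := complex.Re (inner x y).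

(** The squared modulus is taken in R, since the norm of R[i] has its values in R[i]. *)
Definition sqmod (c : C) : R := complex.Re c ^+ 2 + complex.Im c ^+ 2.

Lemma ReD (a b : C) : complex.Re (a + b) = complex.Re a + complex.Re b.
Proof. by case: a b => [? ?] [? ?]. Qed.

Lemma ReN (a : C) : complex.Re (- a) = - complex.Re a.
Proof. by case: a. Qed.

Lemma Re_sum (I : Type) (r : seq I) (P : pred I) (F : I -> C) :
  complex.Re (\sum_(i <- r | P i) F i) = \sum_(i <- r | P i) complex.Re (F i).
Proof. exact: (big_morph _ ReD erefl). Qed.

Lemma Re_mulC (a : R) (c : C) : complex.Re (a%:C%C * c) = a * complex.Re c.
Proof. by case: c => x y /=; rewrite mul0r subr0. Qed.

Lemma mul_conj_sqmod (c : C) : c * c^* = (sqmod c)%:C%C.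
Proof.
by case: c => a b; apply/eqP; rewrite eq_complex /sqmod /=; apply/andP; split; apply/eqP; ring.
Qed.

(** AM-GM: the gap between the two sides is half of |c^* - c'|^2. *)
Lemma Re_mul_le (c c' : C) : complex.Re (c * c') <= (sqmod c + sqmod c') / 2.
Proof.
case: c c' => [a b] [a' b']; rewrite /sqmod /= -subr_ge0.
have -> : (a ^+ 2 + b ^+ 2 + (a' ^+ 2 + b' ^+ 2)) / 2 - (a * a' - b * b') =
  ((a - a') ^+ 2 + (b + b') ^+ 2) / 2 by field.
by rewrite divr_ge0 // addr_ge0 // sqr_ge0.
Qed.

Lemma innerC V (x y : V) : inner x y = (inner y x)^*.
Proof. by have := hermC inner x y; rewrite expr0 mul1r. Qed.

Lemma innerZr V (a : C) (x y : V) : inner x (a *: y) = a^* * inner x y.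
Proof. exact: linearZr_LR. Qed.

Lemma innerZl V (a : C) (x y : V) : inner (a *: x) y = a * inner x y.
Proof. exact: linearZl_LR. Qed.

Lemma inner0l V (y : V) : inner 0 y = 0.
Proof. exact: linear0l. Qed.

Lemma inner0r V (y : V) : inner y 0 = 0.
Proof. exact: linear0r. Qed.

Lemma innerDl V (x y z : V) : inner (x + y) z = inner x z + inner y z.
Proof. exact: linearDl. Qed.

Lemma innerBl V (x y z : V) : inner (x - y) z = inner x z - inner y z.
Proof. exact: linearBl. Qed.

Lemma inner_suml V (I : Type) (r : seq I) (P : pred I) (F : I -> V) (z : V) :
  inner (\sum_(i <- r | P i) F i) z = \sum_(i <- r | P i) inner (F i) z.
Proof. exact: linear_sumlz. Qed.

Lemma inner_sumr V (I : Type) (r : seq I) (P : pred I) (F : I -> V) (z : V) :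
  inner z (\sum_(i <- r | P i) F i) = \sum_(i <- r | P i) inner z (F i).
Proof. exact: linear_sumr. Qed.

Lemma normE V (x : V) : `|x| = (hnorm x)%:C%C.
Proof. by rewrite /hnorm RRe_real // normr_real. Qed.

Lemma hnorm_ge0 V (x : V) : 0 <= hnorm x.
Proof. by have := normr_ge0 x; rewrite normE ler0c. Qed.

Lemma inner_hnorm V (x : V) : inner x x = (hnorm x ^+ 2)%:C%C.
Proof. by rewrite -sqr_norm_inner normE -rmorphXn. Qed.

Lemma sqr_hnorm V (x : V) : hnorm x ^+ 2 = rinner x x.
Proof. by rewrite /rinner inner_hnorm. Qed.

Lemma hnorm1_inner V (x : V) : hnorm x = 1 <-> inner x x = 1.
Proof.
rewrite inner_hnorm; split=> [->|/(congr1 (@complex.Re R)) /= h]; first by rewrite expr1n.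
by apply/eqP; rewrite -(@eqrXn2 _ 2) // ?hnorm_ge0 // h expr1n.
Qed.

Lemma hnorm_eq0 V (x : V) : hnorm x = 0 -> x = 0.
Proof. by move=> h; apply/eqP; rewrite -normr_eq0 normE h. Qed.

Lemma hnorm0 V : hnorm (0 : V) = 0.
Proof. by rewrite /hnorm normr0. Qed.

Lemma hnormZ V (a : C) (x : V) : hnorm (a *: x) = complex.Re `|a| * hnorm x.
Proof.
have : (hnorm (a *: x))%:C%C = `|a| * (hnorm x)%:C%C by rewrite -!normE normrZ.
have /RRe_real <- : `|a| \is Num.real by rewrite normr_real.
by rewrite -rmorphM => /complexI.
Qed.

Lemma hnormZ_real V (a : R) (x : V) : 0 <= a -> hnorm (a%:C%C *: x) = a * hnorm x.
Proof. by move=> a0; rewrite hnormZ ger0_norm ?ler0c. Qed.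

Lemma hnorm_opp V (x : V) : hnorm (- x) = hnorm x.
Proof. by rewrite /hnorm normrN. Qed.

Lemma hnormD_le V (x y : V) : hnorm (x + y) <= hnorm x + hnorm y.
Proof. by have := ler_normD x y; rewrite !normE -rmorphD lecR. Qed.

Lemma rinnerC V (x y : V) : rinner x y = rinner y x.
Proof. by rewrite /rinner innerC; case: (inner y x). Qed.

Lemma rinnerDl V (x y z : V) : rinner (x + y) z = rinner x z + rinner y z.
Proof. by rewrite /rinner innerDl ReD. Qed.

Lemma rinnerNl V (x z : V) : rinner (- x) z = - rinner x z.
Proof. by rewrite /rinner linearNl ReN. Qed.

Lemma rinnerBl V (x y z : V) : rinner (x - y) z = rinner x z - rinner y z.
Proof. by rewrite rinnerDl rinnerNl. Qed.

Lemma rinnerBr V (x y z : V) : rinner z (x - y) = rinner z x - rinner z y.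
Proof. by rewrite ![rinner z _]rinnerC rinnerBl. Qed.

Lemma rinnerZl V (a : R) (x z : V) : rinner (a%:C%C *: x) z = a * rinner x z.
Proof. by rewrite /rinner innerZl Re_mulC. Qed.

Lemma sqr_hnormB V (x y : V) :
  hnorm (x - y) ^+ 2 = hnorm x ^+ 2 + hnorm y ^+ 2 - 2 * rinner x y.
Proof. by rewrite !sqr_hnorm rinnerBl !rinnerBr (rinnerC y x); ring. Qed.

Lemma rinner_le V (x y : V) : rinner x y <= hnorm x * hnorm y.
Proof.
have [x0|x0] := eqVneq (hnorm x) 0.
  by rewrite (hnorm_eq0 x0) hnorm0 mul0r /rinner inner0l.
have [y0|y0] := eqVneq (hnorm y) 0.
  by rewrite (hnorm_eq0 y0) hnorm0 mulr0 /rinner inner0r.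
have xp : 0 < hnorm x by rewrite lt_neqAle eq_sym x0 hnorm_ge0.
have yp : 0 < hnorm y by rewrite lt_neqAle eq_sym y0 hnorm_ge0.
(* Rescaling x and y to the common norm |x| |y| makes the square equal to 2 |x| |y| (|x| |y| - Re
   <x, y>). *)
have := sqr_ge0 (hnorm ((hnorm y)%:C%C *: x - (hnorm x)%:C%C *: y)).
rewrite sqr_hnormB !hnormZ_real ?hnorm_ge0 // rinnerZl rinnerC rinnerZl rinnerC.
set a := hnorm x; set b := hnorm y; set c := rinner x y.
have -> : (b * a) ^+ 2 + (a * b) ^+ 2 - 2 * (b * (a * c)) = (2 * a * b) * (a * b - c).
  by ring.
by rewrite pmulr_rge0 ?subr_ge0 // !mulr_gt0.
Qed.

(** * Closures, half-spaces and convex hulls *)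

Lemma closureP V (A : set V) (x : V) :
  closure A x <-> forall e : R, 0 < e -> exists2 y, A y & hnorm (x - y) < e.
Proof.
split=> [Ax e e0|h B /nbhs_ballP[e /= e0 eB]].
  have e0' : 0 < e%:C%C by rewrite ltcR.
  have [y [Ay]] := Ax _ (nbhsx_ballx x _ e0').
  by rewrite -ball_normE /= normE ltcR => xy; exists y.
(* Radii of balls live in R[i]; a positive one is real. *)
have eE : e = (complex.Re e)%:C%C by rewrite RRe_real // gtr0_real.
move: e0; rewrite eE ltcR => e0.
have [y Ay xy] := h _ e0; exists y; split=> //; apply: eB.
by rewrite -ball_normE /= eE normE ltcR.
Qed.

Lemma hull_min V (A B : set V) : A `<=` B ->
  convex_set (B : set (convex_lmodType V)) ->
  (forall x, closure B x -> B x) -> closed_convex_hull A `<=` B.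
Proof.
move=> AB cB clB x Ax; apply: clB; apply: closure_subset Ax.
exact: smallest_sub.
Qed.

(** A real half-space is convex, and it is closed by Cauchy-Schwarz, so it contains the closed
    convex hull as soon as it contains A. *)
Lemma rinner_hull_le V (A : set V) (z : V) (c : R) :
  (forall v, A v -> rinner v z <= c) ->
  forall x, closed_convex_hull A x -> rinner x z <= c.
Proof.
move=> Ac; apply: (@hull_min _ A [set x | rinner x z <= c]) => //.
  move=> x y t; rewrite !inE /= => xc yc.
  have t0 : 0 <= t%:num by [].
  have t1 : t%:num <= 1 by [].
  (* The weight of a convex combination lives in R[i]; lying between 0 and 1, it is real. *)
  have tE : t%:num = (complex.Re t%:num)%:C%C by rewrite RRe_real // ger0_real.
  rewrite /conv /= /unstable.onem tE; move: t0 t1; rewrite tE ler0c -[1]/(1%:C%C) lecR.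
  set s := complex.Re _ => s0 s1.
  by rewrite -rmorphB rinnerDl !rinnerZl; nra.
move=> x /closureP clx /=; rewrite leNgt; apply/negP => cx.
have z1 : 0 < hnorm z + 1 by rewrite ltr_wpDl ?hnorm_ge0.
(* A point y this close to x would still satisfy [rinner y z > c]; the added 1 covers the case z =
   0. *)
have e0 : 0 < (rinner x z - c) / (hnorm z + 1) by rewrite divr_gt0 // subr_gt0.
have [y /= yc] := clx _ e0; rewrite ltr_pdivlMr // => xy.
have := rinner_le (x - y) z; rewrite rinnerBl.
have := hnorm_ge0 z; have := hnorm_ge0 (x - y); nra.
Qed.

(** The hull before closure: [closed_convex_hull A] is by definition the closure of this set. *)
Definition conv_hull V (A : set V) : set V :=
  smallest (fun B : set V => convex_set (B : set (convex_lmodType V))) A.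

Lemma conv_hull_convex V (A : set V) (x y : V) (t : R) : 0 <= t -> t <= 1 ->
  conv_hull A x -> conv_hull A y ->
  conv_hull A (t%:C%C *: x + (1 - t)%:C%C *: y).
Proof.
move=> t0 t1 Ax Ay B [cB AB].
(* [convex_set] quantifies over the unit interval of R[i], so the real t has to be packed as one of
   its elements. *)
have t01 : Itv.spec (@Itv.num_sem C) (Itv.Real `[0%Z, 1%Z]) t%:C%C.
  by rewrite /= /Itv.num_sem /= realE ler0c t0 /= in_itv /= ler0c t0 /= (lecR t 1).
have := cB x y (Itv.mk t01); rewrite !inE.
move=> /(_ (Ax _ (conj cB AB)) (Ay _ (conj cB AB))).
by rewrite /conv /= /unstable.onem rmorphB.
Qed.

Lemma sub_conv_hull V (A : set V) : A `<=` conv_hull A.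
Proof. exact: sub_smallest. Qed.

(** The mass missing from 1 is put on the point 0. To allow an induction, each partial sum is
    written as its total weight times a point of the hull. *)
Lemma conv_hull_sum V (A : set V) (I : Type) (s : seq I) (w : I -> R) (v : I -> V) :
  conv_hull A 0 -> (forall i, 0 <= w i) -> (forall i, A (v i)) ->
  \sum_(i <- s) w i <= 1 ->
  conv_hull A (\sum_(i <- s) (w i)%:C%C *: v i).
Proof.
move=> A0 w0 Av s1.
suff [h Ah ->] : exists2 h, conv_hull A h &
    \sum_(i <- s) (w i)%:C%C *: v i = (\sum_(i <- s) w i)%:C%C *: h.
  have := conv_hull_convex (sumr_ge0 _ (fun i _ => w0 i)) s1 Ah A0.
  by rewrite scaler0 addr0.
elim: s {s1} => [|i s [h Ah IH]]; first by exists 0 => //; rewrite !big_nil scaler0.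
rewrite !big_cons IH; set W := \sum_(i <- s) w i.
have W0 : 0 <= W by apply: sumr_ge0.
(* If the total weight vanishes, so do both summands, and 0 serves as the point; otherwise one
   divides by the total. *)
have [W'0|W'0] := eqVneq (w i + W) 0.
  have [-> ->] : w i = 0 /\ W = 0 by have := w0 i; split; lra.
  by exists 0 => //; rewrite !scale0r addr0 scaler0.
have W'p : 0 < w i + W by rewrite lt_neqAle eq_sym W'0 addr_ge0.
exists ((w i / (w i + W))%:C%C *: v i + (1 - w i / (w i + W))%:C%C *: h).
  apply: conv_hull_convex => //.
  - by rewrite divr_ge0 // ltW.
  - by rewrite ler_pdivrMr // mul1r lerDl.
  - exact: sub_conv_hull.
rewrite scalerDr !scalerA -!rmorphM; congr (_%:C%C *: _ + _%:C%C *: _); by field.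
Qed.

(** * Distance to a set *)

Lemma dist_to_le V (A : set V) (x y : V) : A y -> dist_to A x <= hnorm (x - y).
Proof.
move=> Ay; apply: ge_inf; last by exists y.
by exists 0 => _ [z _ <-]; exact: hnorm_ge0.
Qed.

Lemma le_dist_to V (A : set V) (x : V) (c : R) :
  A !=set0 -> (forall y, A y -> c <= hnorm (x - y)) -> c <= dist_to A x.
Proof.
move=> [y Ay] cA; apply: lb_le_inf; first by exists (hnorm (x - y)), y.
by move=> _ [z Az <-]; exact: cA.
Qed.
End InnerProduct.

(** * Orthonormal families: Bessel, expansions and existence *)

Section Orthonormal.
Context {R : realType}.
Local Notation C := R[i].
Implicit Types V : hilbertType R.

Lemma linear_spanP V (A B : set V) :
  A `<=` B -> B 0 -> (forall (a : C) u v, B u -> B v -> B (a *: u + v)) ->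
  linear_span A `<=` B.
Proof.
move=> AB B0 Blin _ [n [a [v [Av ->]]]].
elim/big_ind: _ => // [u w Bu Bw|i _]; first by have := Blin 1 _ _ Bu Bw; rewrite scale1r.
by have := Blin (a i) _ _ (AB _ (Av i)) B0; rewrite addr0.
Qed.

Lemma linear_spanB V (A : set V) (x y : V) :
  linear_span A x -> linear_span A y -> linear_span A (x - y).
Proof.
move=> [n [a [v [Av ->]]]] [p [b [w [Aw ->]]]].
exists (n + p)%N,
  (fun i : 'I_(n + p) => match fintype.split i with inl j => a j | inr j => - b j end),
  (fun i : 'I_(n + p) => match fintype.split i with inl j => v j | inr j => w j end).
split=> [i|]; first by case: (fintype.split i).
rewrite big_split_ord /= -sumrN; congr (_ + _); apply: eq_bigr => i _.
  by rewrite (unsplitK (inl i)).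
by rewrite (unsplitK (inr i)) scaleNr.
Qed.

(** For y in the span, orthogonality gives |z|^2 = Re <z - y, z> <= |z - y| |z|. Hence |z| <= |z -
    y| when z is nonzero, and the right-hand side can be made arbitrarily small. *)
Lemma orthogonal_dense_eq0 V (A : set V) (z : V) :
  closure (linear_span A) z -> (forall a, A a -> inner a z = 0) -> z = 0.
Proof.
move=> /closureP Az zA; apply: hnorm_eq0; apply/eqP; rewrite eq_le hnorm_ge0 andbT.
have spanz y : linear_span A y -> inner y z = 0.
  apply: (@linear_spanP V A [set y | inner y z = 0]) => //=; first exact: inner0l.
  by move=> a u v /= u0 v0; rewrite innerDl innerZl u0 v0 mulr0 addr0.
apply/ler_addgt0Pr => e e0; rewrite add0r leNgt; apply/negP => ez.
have [y /spanz yz zy] := Az _ e0.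
have := rinner_le (z - y) z.
rewrite rinnerBl -sqr_hnorm /rinner yz subr0 expr2 ler_pM2r ?(lt_trans e0) //.
by move=> /(lt_le_trans ez) /lt_trans /(_ zy); rewrite ltxx.
Qed.

Lemma sqr_hnorm_orthogonal_sum V (I : finType) (v : I -> V) :
  (forall i j, i != j -> inner (v i) (v j) = 0) ->
  hnorm (\sum_i v i) ^+ 2 = \sum_i hnorm (v i) ^+ 2.
Proof.
move=> vo; rewrite sqr_hnorm /rinner inner_suml Re_sum; apply: eq_bigr => i _.
rewrite inner_sumr (bigD1 i) //= big1 => [|j ji]; first by rewrite addr0 sqr_hnorm.
by rewrite vo // eq_sym.
Qed.

Section Family.
Context {V : hilbertType R} {I : finType} (e : I -> V).
Hypothesis eo : orthonormal_family e.

Lemma orthonormal_hnorm (i : I) : hnorm (e i) = 1.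
Proof. by apply/hnorm1_inner; rewrite eo eqxx. Qed.

Lemma inner_orthonormal_sum (c : I -> C) (j : I) :
  inner (\sum_i c i *: e i) (e j) = c j.
Proof.
rewrite inner_suml (bigD1 j) //= innerZl eo eqxx mulr1 big1 ?addr0 // => i ij.
by rewrite innerZl eo (negbTE ij) mulr0.
Qed.

(** Expand 0 <= |x - p|^2 for the projection p of x: both |p|^2 and Re <x, p> equal the sum on the
    left. *)
Lemma bessel (x : V) : \sum_i sqmod (inner x (e i)) <= hnorm x ^+ 2.
Proof.
pose p := \sum_i inner x (e i) *: e i.
have pE : rinner p p = \sum_i sqmod (inner x (e i)).
  rewrite /rinner {2}/p inner_sumr Re_sum; apply: eq_bigr => i _.
  by rewrite innerZr inner_orthonormal_sum mulrC mul_conj_sqmod.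
have xp : rinner x p = \sum_i sqmod (inner x (e i)).
  rewrite /rinner {1}/p inner_sumr Re_sum; apply: eq_bigr => i _.
  by rewrite innerZr mulrC mul_conj_sqmod.
have := sqr_ge0 (hnorm (x - p)).
by rewrite sqr_hnormB [hnorm p ^+ 2]sqr_hnorm pE xp; lra.
Qed.

Lemma inner_residue (x : V) (j : I) :
  inner (e j) (x - \sum_i inner x (e i) *: e i) = 0.
Proof. by rewrite innerC innerBl inner_orthonormal_sum subrr conjC0. Qed.

Lemma linear_span_family (c : I -> C) :
  linear_span (range e) (\sum_i c i *: e i).
Proof.
exists #|I|, (c \o enum_val), (e \o enum_val); split; first by move=> i; exists (enum_val i).
by rewrite (reindex_onto enum_val enum_rank) => [|i _]; rewrite ?enum_rankK //;
   apply: eq_bigl => i; rewrite enum_valK eqxx.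
Qed.

(** The difference between x and its projection is orthogonal to the family and still lies in the
    closed span, because subtracting the projection from approximants of x keeps them in the span.
    So it vanishes. *)
Lemma closed_span_expansion (x : V) :
  closure (linear_span (range e)) x -> x = \sum_i inner x (e i) *: e i.
Proof.
move=> /closureP ex; apply/eqP; rewrite -subr_eq0; apply/eqP.
apply: (@orthogonal_dense_eq0 _ (range e)); last by move=> _ [j _ <-]; exact: inner_residue.
apply/closureP => r /ex [y ey xy].
exists (y - \sum_i inner x (e i) *: e i); last by rewrite opprB addrA subrK.
exact: linear_spanB (linear_span_family _).
Qed.
End Family.

(** One Gram-Schmidt step: take a vector outside the closed span, subtract its projection and
    normalise. *)
Lemma orthonormal_extend V (n : nat) (e : 'I_n -> V) :
  orthonormal_family e -> ~ orthonormal_basis e ->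
  exists e' : 'I_n.+1 -> V, orthonormal_family e'.
Proof.
move=> eo ne.
have [x nx] : exists x, ~ closure (linear_span (range e)) x.
  by apply/existsNP => h; apply: ne; split=> //; apply/seteqP; split.
pose z := x - \sum_i inner x (e i) *: e i.
have z0 : hnorm z != 0.
  apply/eqP => /hnorm_eq0 /eqP; rewrite subr_eq0 => /eqP xE; apply: nx.
  by apply: subset_closure; rewrite xE; exact: linear_span_family.
pose u := ((hnorm z)^-1)%:C%C *: z.
have uu : inner u u = 1.
  by apply/hnorm1_inner; rewrite hnormZ_real ?invr_ge0 ?hnorm_ge0 // mulVf.
have eu j : inner (e j) u = 0 by rewrite innerZr inner_residue // mulr0.
have ue j : inner u (e j) = 0 by rewrite innerC eu conjC0.
exists (fun i => oapp e u (unlift ord_max i)) => i j.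
by case: unliftP => [i' ->|->]; case: unliftP => [j' ->|->] /=;
   rewrite ?(inj_eq (@lift_inj _ _)) ?eqxx ?eu ?ue // ?(negbTE (neq_lift _ _)) //
     eq_sym (negbTE (neq_lift _ _)).
Qed.

(** In finite dimension, part of a basis is reindexed by I. In infinite dimension no finite
    orthonormal family is a basis, so families of every finite size arise by repeated extension. *)
Lemma orthonormal_exists V (d : option nat) (I : finType) :
  hilbert_dim V d -> dim_le (Some #|I|) d -> exists f : I -> V, orthonormal_family f.
Proof.
move=> dV Id.
suff [q Iq [e eo]] : exists2 q, (#|I| <= q)%N &
    exists e : 'I_q -> V, orthonormal_family e.
  exists (fun i => e (widen_ord Iq (enum_rank i))) => i j.
  by rewrite eo -(inj_eq (@enum_rank_inj I)).
case: d dV Id => [q [e [eo _]] Iq|dV _]; first by exists q => //; exists e.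
exists #|I| => //; elim: #|I| => [|n [e eo]]; first by exists (fun=> 0) => -[].
exact: orthonormal_extend eo (dV _ e).
Qed.

(** With an empty basis every vector would equal the empty sum. *)
Lemma hilbert_dim_gt0 V (n : nat) : (exists x : V, x != 0) ->
  hilbert_dim V (Some n) -> (0 < n)%N.
Proof.
case=> x x0 [e [eo eV]]; case: n e eo eV => // e eo eV.
have xE : x = 0; last by rewrite xE eqxx in x0.
by rewrite (@closed_span_expansion _ _ e eo x) ?eV // big_ord0.
Qed.

Lemma unit_vector_exists V : (exists x : V, x != 0) -> exists x : V, hnorm x = 1.
Proof.
case=> x x0; exists (((hnorm x)^-1)%:C%C *: x).
rewrite hnormZ_real ?invr_ge0 ?hnorm_ge0 // mulVf //.
by apply: contra_neq x0; exact: hnorm_eq0.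
Qed.
End Orthonormal.

(** * Families with a distinguished last entry *)

Lemma snoc_fam_eta (m : nat) (H : 'I_m.+1 -> Type) (x : forall k, H k) :
  x = snoc_fam (fun k => x (lift ord_max k)) (x ord_max).
Proof.
apply: functional_extensionality_dep => k.
by case: (unliftP ord_max k) => [j ->|->]; rewrite ?snoc_fam_lift ?snoc_fam_max.
Qed.

Lemma dfwith_eta (I : eqType) (H : I -> Type) (x : forall k, H k) (k : I) :
  x = eqtype.dfwith x (x k).
Proof. by apply: functional_extensionality_dep => j; case: eqtype.dfwithP. Qed.

(** Multilinearity is stated through [dfwith]; this form, with an arbitrary placeholder z, lets it
    act on the last factor. *)
Lemma snoc_fam_dfwith (m : nat) (H : 'I_m.+1 -> Type)
    (x : forall k : 'I_m, H (lift ord_max k)) (y z : H ord_max) :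
  snoc_fam x y = eqtype.dfwith (snoc_fam x z) y.
Proof.
apply: functional_extensionality_dep => k.
case: (unliftP ord_max k) => [j ->|->].
  by rewrite eqtype.dfwith_out ?snoc_fam_lift // neq_lift.
by rewrite eqtype.dfwith_in snoc_fam_max.
Qed.

(** * Multilinearity and decomposable unit vectors *)

Section TensorProduct.
Context {R : realType} {I : finType} {H : I -> hilbertType R} (T : hilbertTensor H).
Local Notation C := R[i].
Implicit Types x : forall k, H k.

Lemma tens0 x (k : I) : tens T (eqtype.dfwith x (0 : H k)) = 0.
Proof.
(* With a = 1 and two zero vectors, multilinearity reads t = t + t. *)
have := tens_multilinear T x 1 (0 : H k) 0.
by rewrite !scale1r addr0 => /eqP; rewrite -subr_eq subrr => /eqP.
Qed.

Lemma tensZ x (k : I) (a : C) (u : H k) :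
  tens T (eqtype.dfwith x (a *: u)) = a *: tens T (eqtype.dfwith x u).
Proof. by have := tens_multilinear T x a u 0; rewrite !addr0 tens0 addr0. Qed.

Lemma tens_sum x (k : I) (J : Type) (s : seq J) (a : J -> C) (v : J -> H k) :
  tens T (eqtype.dfwith x (\sum_(j <- s) a j *: v j)) =
  \sum_(j <- s) a j *: tens T (eqtype.dfwith x (v j)).
Proof.
elim: s => [|j s IH]; first by rewrite !big_nil tens0.
by rewrite !big_cons tens_multilinear IH.
Qed.

Lemma decomposable_unit_hnorm (v : T) : decomposable_unit T v -> hnorm v = 1.
Proof.
move=> [x /= x1 <-]; apply/hnorm1_inner; rewrite inner_tens big1 // => k _.
exact/hnorm1_inner.
Qed.

(** The sign is absorbed by the factor k. This symmetry makes 0 the midpoint of two decomposable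
    unit vectors. *)
Lemma decomposable_unitN (k : I) (v : T) :
  decomposable_unit T v -> decomposable_unit T (- v).
Proof.
move=> [x /= x1 <-]; exists (eqtype.dfwith x (- x k)).
  by move=> j /=; case: eqtype.dfwithP => [|j' _] //; rewrite hnorm_opp.
by rewrite -scaleN1r tensZ -dfwith_eta scaleN1r.
Qed.

Lemma decomposable_unit_nonempty : (forall k, exists x : H k, x != 0) ->
  exists v, decomposable_unit T v.
Proof.
move=> H0; pose x k := cid (unit_vector_exists (H0 k)).
by exists (tens T (fun k => sval (x k))), (fun k => sval (x k)) => // k; exact: (svalP (x k)).
Qed.

Lemma conv_hull_decomposable0 : I -> (forall k, exists x : H k, x != 0) ->
  conv_hull (decomposable_unit T) 0.
Proof.
move=> k /decomposable_unit_nonempty [v Vv].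
have -> : 0 = (2^-1)%:C%C *: v + (1 - 2^-1)%:C%C *: - v.
  have -> : (1 - 2^-1 : R) = 2^-1 by field.
  by rewrite scalerN subrr.
apply: conv_hull_convex; rewrite ?invr_ge0 ?invf_le1 ?ler1n //.
  exact: sub_conv_hull.
by apply: sub_conv_hull; apply: decomposable_unitN.
Qed.
End TensorProduct.

(** * Expansion along the product basis of the first N - 1 factors *)

Section Sliced.
Context {R : realType} {m : nat} {H : 'I_m.+1 -> hilbertType R} (T : hilbertTensor H).
Local Notation C := R[i].
Context {n : 'I_m -> nat} (e : forall k : 'I_m, 'I_(n k) -> H (lift ord_max k)).
Arguments e : clear implicits.
Local Notation J := {dffun forall k : 'I_m, 'I_(n k)}.

Lemma inner_tens_snoc (x x' : forall k : 'I_m, H (lift ord_max k)) (y y' : H ord_max) :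
  inner (tens T (snoc_fam x y)) (tens T (snoc_fam x' y')) =
  inner y y' * \prod_k inner (x k) (x' k).
Proof.
rewrite inner_tens (bigD1_ord ord_max) //= !snoc_fam_max; congr (_ * _).
by apply: eq_bigr => k _; rewrite !snoc_fam_lift.
Qed.

(** This is e_i (x) y for the multi-index i. When the [e k] are orthonormal bases, each [slice i] is
    an isometric linear embedding of the last factor, and distinct i give orthogonal images. *)
Definition slice (i : J) (y : H ord_max) : T :=
  tens T (snoc_fam (fun k => e k (i k)) y).

Lemma slice_linear (i : J) (a : C) (u v : H ord_max) :
  slice i (a *: u + v) = a *: slice i u + slice i v.
Proof.
rewrite /slice (snoc_fam_dfwith _ _ (0 : H ord_max)) tens_multilinear.
by rewrite -!snoc_fam_dfwith.
Qed.

Lemma slice0 (i : J) : slice i 0 = 0.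
Proof. by rewrite /slice (snoc_fam_dfwith _ _ (0 : H ord_max)) tens0. Qed.

Lemma sliceZ (i : J) (a : C) (u : H ord_max) : slice i (a *: u) = a *: slice i u.
Proof. by have := slice_linear i a u 0; rewrite slice0 !addr0. Qed.

(** Since there are finitely many multi-indices, these are finite sums with arbitrary coefficients
    in the last factor, which may itself be infinite-dimensional. *)
Definition sliced : set T := [set w | exists g : J -> H ord_max, w = \sum_i slice i (g i)].

Lemma sliced_slice (i : J) (y : H ord_max) : sliced (slice i y).
Proof.
exists (fun j => if j == i then y else 0).
rewrite (bigD1 i) //= eqxx big1 ?addr0 // => j /negbTE ->; exact: slice0.
Qed.

Lemma sliced_linear (a : C) (u v : T) : sliced u -> sliced v -> sliced (a *: u + v).
Proof.
move=> [g ->] [g' ->]; exists (fun i => a *: g i + g' i).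
by rewrite scaler_sumr -big_split; apply: eq_bigr => i _; rewrite slice_linear.
Qed.

Lemma sliced0 : sliced 0.
Proof. by exists (fun=> 0); rewrite big1 // => i _; exact: slice0. Qed.

Lemma slicedZ (a : C) (u : T) : sliced u -> sliced (a *: u).
Proof. by move=> su; have := sliced_linear a su sliced0; rewrite addr0. Qed.

Section Basis.
Hypothesis eb : forall k, orthonormal_basis (e k).

(* Expand the factors one after the other: [j] bounds the factors that may
   still be different from basis vectors. *)
Lemma sliced_tens_rec (j : nat) (x : forall k, H k) :
  (forall k : 'I_m, (j <= k)%N -> exists l, x (lift ord_max k) = e k l) ->
  sliced (tens T x).
Proof.
elim: j x => [|j IH] x xe.
  pose l k := cid (xe k isT).
  have := sliced_slice [ffun k => sval (l k)] (x ord_max).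
  rewrite /slice; congr (sliced (tens T _)); rewrite [RHS]snoc_fam_eta.
  congr snoc_fam; apply: functional_extensionality_dep => k.
  by rewrite ffunE; exact: esym (svalP (l k)).
have [jm|mj] := ltnP j m; last first.
  by apply: IH => k jk; have := ltn_ord k; rewrite ltnNge (leq_trans mj jk).
pose k0 := Ordinal jm.
rewrite (dfwith_eta x (lift ord_max k0)).
have [eo eV] := eb k0.
rewrite (closed_span_expansion eo (x := x (lift ord_max k0))) ?eV // tens_sum.
elim/big_ind: _ => [|u v su sv|l _]; first exact: sliced0.
  by rewrite -[u]scale1r; exact: sliced_linear.
apply: slicedZ; apply: IH => k; rewrite leq_eqVlt => /predU1P[jk|jk].
  have -> : k = k0 by apply: val_inj.
  by exists l; rewrite eqtype.dfwith_in.
have [l' le] := xe _ jk; exists l'; rewrite eqtype.dfwith_out //.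
by rewrite (inj_eq lift_inj) -val_eqE /= ltn_eqF.
Qed.

(** The sliced vectors form a subspace containing all decomposable tensors, and the latter are
    total. *)
Lemma closure_sliced : closure sliced = setT.
Proof.
apply/seteqP; split=> // x _.
have : closure (linear_span (range (tens T))) x by rewrite tens_total.
apply: closure_subset; apply: linear_spanP => [_ [y _ <-]||]; last exact: sliced_linear.
  (* With the bound m, no factor is required to be a basis vector. *)
  by apply: (@sliced_tens_rec m) => k; rewrite leqNgt ltn_ord.
exact: sliced0.
Qed.

Lemma inner_slice (i j : J) (y z : H ord_max) :
  inner (slice i y) (slice j z) = (i == j)%:R * inner y z.
Proof.
rewrite inner_tens_snoc mulrC; congr (_ * _).
have [<-|ij] := eqVneq i j; first by rewrite big1 // => k _; rewrite (eb k).1 eqxx.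
have /existsP [k ijk] : [exists k, i k != j k].
  apply: contraR ij; rewrite negb_exists => /forallP ij.
  by apply/eqP/ffunP => k; apply/eqP; rewrite -[_ == _]negbK.
by rewrite (bigD1 k) //= (eb k).1 (negbTE ijk) mul0r.
Qed.

Lemma hnorm_slice (i : J) (y : H ord_max) : hnorm (slice i y) = hnorm y.
Proof.
apply/eqP; rewrite -(@eqrXn2 _ 2) ?hnorm_ge0 // !sqr_hnorm /rinner inner_slice eqxx.
by rewrite mul1r.
Qed.

Lemma sqr_hnorm_sliced (g : J -> H ord_max) :
  hnorm (\sum_i slice i (g i)) ^+ 2 = \sum_i hnorm (g i) ^+ 2.
Proof.
rewrite sqr_hnorm_orthogonal_sum => [|i j ij]; last by rewrite inner_slice (negbTE ij) mul0r.
by apply: eq_bigr => i _; rewrite hnorm_slice.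
Qed.
End Basis.
End Sliced.

(** * The ball of radius r lies in the closed convex hull *)

Section BallInHull.
Context {R : realType} {m : nat} {H : 'I_m.+1 -> hilbertType R} (T : hilbertTensor H).
Context {n : 'I_m -> nat} {e : forall k : 'I_m, 'I_(n k) -> H (lift ord_max k)}.
Local Notation C := R[i].
Local Notation J := {dffun forall k : 'I_m, 'I_(n k)}.
Hypothesis H_nonzero : forall k, exists x : H k, x != 0.
Hypothesis eb : forall k, orthonormal_basis (@e k).
Hypothesis n0 : (0 < #|J|)%N.
Local Notation r := ((Num.sqrt (#|J|%:R : R))^-1).

Lemma radius_gt0 : 0 < r.
Proof. by rewrite invr_gt0 sqrtr_gt0 ltr0n. Qed.

Lemma sqr_radius : r ^+ 2 = #|J|%:R^-1.
Proof. by rewrite exprVn sqr_sqrtr ?ler0n. Qed.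

Lemma decomposable_unit_slice (i : J) (y : H ord_max) :
  hnorm y = 1 -> decomposable_unit T (slice T e i y).
Proof.
move=> y1; exists (snoc_fam (fun k => e (i k)) y) => // k.
case: (unliftP ord_max k) => [k' ->|->]; rewrite ?snoc_fam_max ?snoc_fam_lift //.
exact: orthonormal_hnorm (eb k').1 _.
Qed.

(* AM-GM in the form [2 |g i| <= #|J| |g i|^2 + 1 / #|J|]. *)
Lemma sum_hnorm_le1 (g : J -> H ord_max) :
  hnorm (\sum_i slice T e i (g i)) <= r -> \sum_i hnorm (g i) <= 1.
Proof.
move=> gr; set N : R := #|J|%:R.
have N0 : 0 < N by rewrite ltr0n.
have gN : \sum_i hnorm (g i) ^+ 2 <= N^-1.
  by rewrite -(sqr_hnorm_sliced T eb) -sqr_radius lerXn2r // nnegrE ?hnorm_ge0 //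
    ltW // radius_gt0.
have amgm i : hnorm (g i) <= (N * hnorm (g i) ^+ 2 + N^-1) / 2.
  rewrite -subr_ge0.
  have -> : (N * hnorm (g i) ^+ 2 + N^-1) / 2 - hnorm (g i) =
    (N * hnorm (g i) - 1) ^+ 2 / (2 * N) by field; rewrite gt_eqF.
  by rewrite divr_ge0 ?sqr_ge0 // mulr_ge0 // ltW.
apply: le_trans (ler_sum _ (fun i _ => amgm i)) _.
rewrite -mulr_suml big_split /= -mulr_sumr sumr_const -[N^-1 *+ _]mulr_natr mulVf ?gt_eqF //.
rewrite ler_pdivrMr // mul1r -[2]/(1 + 1 : R) lerD2r.
by rewrite -(ler_pM2l N0) mulfV ?gt_eqF in gN.
Qed.

Lemma sliced_ball_hull (w : T) :
  sliced e w -> hnorm w <= r -> conv_hull (decomposable_unit T) w.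
Proof.
move=> [g ->] /sum_hnorm_le1 g1.
have [u0 u01] := unit_vector_exists (H_nonzero ord_max).
(* The direction of [g i]; when [g i] vanishes its weight is 0 and any unit vector will do. *)
pose u i := if hnorm (g i) == 0 then u0 else ((hnorm (g i))^-1)%:C%C *: g i.
have u1 i : hnorm (u i) = 1.
  rewrite /u; case: eqVneq => // gi0.
  by rewrite hnormZ_real ?invr_ge0 ?hnorm_ge0 // mulVf.
have uE i : g i = (hnorm (g i))%:C%C *: u i.
  rewrite /u; case: eqVneq => [gi0|gi0]; first by rewrite gi0 scale0r (hnorm_eq0 gi0).
  by rewrite scalerA -rmorphM mulfV // scale1r.
rewrite (eq_bigr (fun i => (hnorm (g i))%:C%C *: slice T e i (u i))); last first.
  by move=> i _; rewrite {1}uE sliceZ.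
apply: conv_hull_sum => //.
- exact: conv_hull_decomposable0 ord_max H_nonzero.
- by move=> i; exact: hnorm_ge0.
- by move=> i; exact: decomposable_unit_slice.
Qed.

Lemma ball_hull (x : T) : hnorm x <= r -> closed_convex_hull (decomposable_unit T) x.
Proof.
move=> xr; have r0 := radius_gt0.
apply/closureP => d d0.
(* An approximant w may fall outside the ball. Rescaling it to norm r then moves it by |w| - r <= |w
   - x| < d / 2, whence the halving of d. *)
have /closureP /(_ (d / 2)) : closure (sliced e) x by rewrite (closure_sliced T eb).
have d20 : 0 < d / 2 by rewrite divr_gt0.
move=> /(_ d20) [w sw xw].
have [wr|rw] := leP (hnorm w) r.
  exists w; last by lra.
  exact: sliced_ball_hull.
have w0 : 0 < hnorm w by apply: lt_trans rw.
have t1 : r / hnorm w <= 1 by rewrite ler_pdivrMr // mul1r ltW.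
have t0 : 0 <= r / hnorm w by rewrite divr_ge0 // ltW.
exists ((r / hnorm w)%:C%C *: w).
  apply: sliced_ball_hull; first exact: slicedZ.
  by rewrite hnormZ_real // divfK // gt_eqF.
have wtw : hnorm (w - (r / hnorm w)%:C%C *: w) = hnorm w - r.
  rewrite -{1}[w]scale1r -scalerBl -[1 : C]/(1%:C%C) -rmorphB hnormZ_real ?subr_ge0 //.
  by rewrite mulrBl mul1r divfK // gt_eqF.
have := hnormD_le (x - w) (w - (r / hnorm w)%:C%C *: w).
rewrite addrA subrK wtw.
have := hnormD_le (w - x) x; rewrite subrK -(hnorm_opp (w - x)) opprB; lra.
Qed.

(** * The bound given by xi, the inner radius and maximality *)

Section MaximalVector.
Context (f : J -> H ord_max).
Hypothesis fo : orthonormal_family f.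
Let xi : T := r%:C%C *: \sum_i slice T e i (f i).

Lemma hnorm_xi : hnorm xi = 1.
Proof.
apply/eqP; rewrite -(@eqrXn2 _ 2) ?hnorm_ge0 // expr1n hnormZ_real ?(ltW radius_gt0) //.
rewrite exprMn sqr_hnorm_sliced // sqr_radius.
rewrite (eq_bigr (fun=> 1)) => [|i _]; last by rewrite orthonormal_hnorm // expr1n.
by rewrite sumr_const mulVf // pnatr_eq0 -lt0n.
Qed.

(** Write y for the last factor of v. Then <v, e_i (x) f_i> is the product of <y, f_i> and <v, e_i
    (x) y>. AM-GM bounds the sum of these products by half of two Bessel sums, each at most 1. *)
Lemma rinner_xi_le (v : T) : decomposable_unit T v -> rinner v xi <= r.
Proof.
move=> Vv; have v1 := decomposable_unit_hnorm Vv; move: Vv => [x /= x1 vE].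
rewrite rinnerC rinnerZl rinnerC -[leRHS]mulr1 ler_wpM2l ?(ltW radius_gt0) //.
set y := x ord_max; have y1 : hnorm y = 1 by exact: x1.
(* The product of the first N - 1 spaces is not formed on its own; the vectors e_i (x) y of T play
   the role of its basis. *)
have slo : orthonormal_family (fun i => slice T e i y).
  by move=> i j; rewrite inner_slice // ((hnorm1_inner _).1 y1) mulr1.
have inner_v i z : inner v (slice T e i z) = inner y z * inner v (slice T e i y).
  rewrite -vE (snoc_fam_eta x) !inner_tens_snoc -/y ((hnorm1_inner y).1 y1) mul1r //.
have vb : \sum_i sqmod (inner v (slice T e i y)) <= 1.
  by have := bessel slo v; rewrite v1 expr1n.
have yb : \sum_i sqmod (inner y (f i)) <= 1.
  by have := bessel fo y; rewrite y1 expr1n.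
rewrite /rinner inner_sumr Re_sum.
apply: (@le_trans _ _ (\sum_i (sqmod (inner y (f i)) +
    sqmod (inner v (slice T e i y))) / 2)).
  by apply: ler_sum => i _; rewrite inner_v; exact: Re_mul_le.
rewrite -mulr_suml big_split /=; lra.
Qed.

Lemma inner_radius_decomposable : is_inner_radius (decomposable_unit T) r.
Proof.
have r0 := ltW radius_gt0.
split=> [|s [s0 sV]]; first by split => // x; exact: ball_hull.
have sxi : hnorm (s%:C%C *: xi) <= s by rewrite hnormZ_real // hnorm_xi mulr1.
have := rinner_hull_le rinner_xi_le (sV _ sxi).
by rewrite rinnerZl -sqr_hnorm hnorm_xi expr1n mulr1.
Qed.

(** If d is the distance, every v in V satisfies Re <v, y> <= 1 - d^2 / 2, and this passes to the
    closed convex hull. The hull contains r y, so r <= 1 - d^2 / 2. *)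
Lemma dist_to_decomposable_le (y : T) :
  hnorm y = 1 -> dist_to (decomposable_unit T) y <= Num.sqrt (2 - 2 * r).
Proof.
move=> y1; have V0 := decomposable_unit_nonempty T H_nonzero.
set d := dist_to _ y.
have d0 : 0 <= d by apply: le_dist_to => // v _; exact: hnorm_ge0.
have Vd v : decomposable_unit T v -> rinner v y <= 1 - d ^+ 2 / 2.
  move=> Vv; have := dist_to_le y Vv; rewrite -/d => dv.
  have := lerXn2r 2 d0 (hnorm_ge0 _) dv.
  rewrite sqr_hnormB y1 (decomposable_unit_hnorm Vv) rinnerC expr1n; lra.
have yr : hnorm (r%:C%C *: y) <= r by rewrite hnormZ_real ?(ltW radius_gt0) // y1 mulr1.
have := rinner_hull_le Vd (ball_hull yr).
rewrite rinnerZl -sqr_hnorm y1 expr1n mulr1 => rd.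
by rewrite -[d]ger0_norm // -sqrtr_sqr ler_wsqrtr //; lra.
Qed.

Lemma dist_to_xi_ge : Num.sqrt (2 - 2 * r) <= dist_to (decomposable_unit T) xi.
Proof.
apply: le_dist_to; first exact: decomposable_unit_nonempty.
move=> v Vv; rewrite -[leRHS]ger0_norm ?hnorm_ge0 // -sqrtr_sqr ler_wsqrtr //.
have := rinner_xi_le Vv.
rewrite sqr_hnormB hnorm_xi (decomposable_unit_hnorm Vv) rinnerC expr1n; lra.
Qed.

Lemma maximal_vector_xi : maximal_vector (decomposable_unit T) xi.
Proof.
split; first exact: hnorm_xi.
have Dub : ubound [set dist_to (decomposable_unit T) y | y in [set y | hnorm y = 1]]
    (Num.sqrt (2 - 2 * r)).
  by move=> _ [y /= y1 <-]; exact: dist_to_decomposable_le.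
apply/eqP; rewrite eq_le; apply/andP; split.
  apply: ub_le_sup; first by exists (Num.sqrt (2 - 2 * r)).
  by exists xi => //; exact: hnorm_xi.
apply: le_trans dist_to_xi_ge; apply: ge_sup => //.
by exists (dist_to (decomposable_unit T) xi), xi => //; exact: hnorm_xi.
Qed.
End MaximalVector.
End BallInHull.

(** * Counting multi-indices and concluding *)

Lemma card_dffun_ord (m : nat) (n : 'I_m -> nat) :
  #|{dffun forall k : 'I_m, 'I_(n k)}| = (\prod_k n k)%N.
Proof.
rewrite card_dep_ffun foldrE big_image /=.
by apply: eq_bigr => k _; rewrite card_ord.
Qed.

(* N = m.+1; the first N - 1 spaces are the H (lift ord_max k) for k < m, and
   the last one is H ord_max. *)
Theorem theorem10p2 (R : realType) (m : nat) (hm : (2 <= m.+1)%N)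
  (H : 'I_m.+1 -> hilbertType R)
  (H_nonzero : forall k, exists x : H k, x != 0)
  (d : 'I_m.+1 -> option nat) (dE : forall k, hilbert_dim (H k) (d k))
  (d_mono : forall j k : 'I_m.+1, (j <= k)%N -> dim_le (d j) (d k))
  (n : 'I_m -> nat) (nE : forall k : 'I_m, d (lift ord_max k) = Some (n k))
  (d_large : dim_le (Some (\prod_k n k)%N) (d ord_max))
  (T : hilbertTensor H) :
  is_inner_radius (decomposable_unit T) (Num.sqrt (\prod_k n k)%N%:R)^-1 /\
  forall (e : forall k : 'I_m, 'I_(n k) -> H (lift ord_max k))
    (f : {dffun forall k : 'I_m, 'I_(n k)} -> H ord_max),
    (forall k, orthonormal_basis (e k)) -> orthonormal_family f ->
    maximal_vector (decomposable_unit T)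
      ((Num.sqrt (\prod_k n k)%N%:R)^-1%:C%C *:
         \sum_(i : {dffun forall k : 'I_m, 'I_(n k)})
            tens T (snoc_fam (fun k => e k (i k)) (f i))).
Proof.
have n_dim k : hilbert_dim (H (lift ord_max k)) (Some (n k)) by rewrite -nE.
have n0 : (0 < #|{dffun forall k : 'I_m, 'I_(n k)}|)%N.
  by rewrite card_dffun_ord prodn_gt0 // => k; exact: hilbert_dim_gt0 (n_dim k).
rewrite -card_dffun_ord in d_large *.
split; last by move=> e f eb fo; exact: (maximal_vector_xi T H_nonzero eb n0 fo).
pose e k := cid (n_dim k).
(* The radius does not mention f, but its upper bound is tested on some xi; the size of the last
   space provides the orthonormal family defining it. *)
have [f fo] := orthonormal_exists (dE ord_max) d_large.
exact: (inner_radius_decomposable T H_nonzero (fun k => svalP (e k)) n0 fo).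
Qed.
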